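(* Let $n\in\mathbb{N}$ and let $\mathbf{i}=(i_1,\dots,i_n)$ be a weight vector. Then every $\mathbf{i}$-badly approximable vector is $\mathbf{i}$-Dirichlet improvable, i.e. $\mathbf{Bad}_n(\mathbf{i})\subseteq\mathcal{D}_n(\mathbf{i})$.
   Context: For a real number $x$, $\|x\|$ denotes the distance from $x$ to the nearest integer. A weight vector is $\mathbf{i}=(i_1,\dots,i_n)\in\mathbb{R}^n$ with $0\le i_j\le 1$ for all $j$ and $i_1+\dots+i_n=1$. A vector $\boldsymbol{\alpha}=(\alpha_1,\dots,\alpha_n)$ is $\mathbf{i}$-badly approximable, written $\boldsymbol{\alpha}\in\mathbf{Bad}_n(\mathbf{i})$, if $$\liminf_{q\to\infty}\max_{1\le j\le n}q^{i_j}\|q\alpha_j\|>0 .$$ A vector $\boldsymbol{\alpha}\in\mathbb{R}^n$ is $\mathbf{i}$-Dirichlet improvable, written $\boldsymbol{\alpha}\in\mathcal{D}_n(\mathbf{i})$, if there exists a constant $0<c<1$ such that for all sufficiently large $Q\in\mathbb{N}$ there is an integer $q$ with $1\le q\le Q$ and $$\|q\alpha_j\|<c\,Q^{-i_j}\quad\text{for all }j\in\{1,\dots,n\}.$$ *)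

(* Defs.v *)
From HB Require Import structures.
From mathcomp Require Import all_boot all_order all_algebra.
From mathcomp Require Import all_classical all_reals all_analysis.
Set Implicit Arguments.
Unset Strict Implicit.
Unset Printing Implicit Defensive.
Import Order.TTheory GRing.Theory Num.Theory.
Import numFieldNormedType.Exports.
Local Open Scope classical_set_scope.
Local Open Scope ring_scope.

Definition dist_int (R : realType) (x : R) : R :=
  inf [set `|x - m%:~R| | m in [set: int]].

(* There is no weight vector for n = 0, since the empty sum is not 1. *)
Definition weight_vector (R : realType) (n : nat) (i : 'rV[R]_n) : Prop :=
  (forall j : 'I_n, 0 <= i 0 j <= 1) /\ \sum_(j < n) i 0 j = 1.

(* The maximum starts from 0, which is harmless as every term is nonnegative.
   The liminf is taken in \bar R so that it is always meaningful. *)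
Definition Bad (R : realType) (n : nat) (i : 'rV[R]_n) : set 'rV[R]_n :=
  [set a | (0 < limn_einf (fun q : nat =>
     (\big[Num.max/0]_(j < n) (q%:R `^ i 0 j * dist_int (q%:R * a 0 j)))%:E))%E].

Definition Dirichlet_improvable (R : realType) (n : nat) (i : 'rV[R]_n) :
    set 'rV[R]_n :=
  [set a | exists2 c : R, 0 < c < 1 &
     \forall Q \near \oo, exists2 q : nat, (1 <= q <= Q)%N &
       forall j : 'I_n, dist_int (q%:R * a 0 j) < c * Q%:R `^ (- i 0 j)].

(* Main.v *)
Require Import Defs.
From mathcomp Require Import all_boot all_order all_algebra.
From mathcomp Require Import all_classical all_reals all_analysis.
From mathcomp Require Import zify ring lra.
Set Implicit Arguments.
Unset Strict Implicit.
Unset Printing Implicit Defensive.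
Import Order.TTheory GRing.Theory Num.Theory.

(** Suppose that, for some c = 1 - kappa with kappa small and some large Q, no
    q <= Q satisfies ||q x_j|| < c Q^(-w_j) for all j.  Then for the rotation
    by x of the torus, the first Q + 1 translates of the box of sides
    c Q^(-w_j) are disjoint and nearly tile the torus.  Hence along almost all
    orbits the visits to the box are spaced by nearly exactly Q + 1, so every
    r = O(Q) with ||r x_j|| <= Q^(-w_j) / 4 is a multiple of Q + 1 up to
    O(kappa Q).  Dirichlet's theorem provides such r_1 = a_1 (Q + 1) + f_1 and
    r_2 = a_2 (Q + 1) + f_2, the second with error at most Q^(-w_j) / N.  The
    integer a_2 r_1 - a_1 r_2 = a_2 f_1 - a_1 f_2 is O(kappa Q) and has error
    O(Q^(-w_j)): if it is nonzero, x is not badly approximable; if it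
    vanishes, the error of r_1 is a_1 / a_2 times that of r_2, hence
    O(Q^(-w_j) / N), and again x is not badly approximable.
    The torus is replaced by a fine grid (Z/(N+1)Z)^I, so that measures are
    cardinals.  Coordinates of weight 0 are dropped beforehand: they impose
    nothing on a Dirichlet improvable vector as soon as c > 1/2. *)

(** * Return times in a finite dynamical system *)

Definition uncovered (T : finType) (tau : T -> T) (B : {set T}) (Q : nat) :
    {set T} :=
  ~: [set iter p.1 tau p.2 | p : 'I_Q.+1 * T in finset.setX [set: 'I_Q.+1] B].

(** For injective [tau] this amounts to the disjointness of the translates of [B] by [tau^0], ...,
    [tau^Q]. *)
Definition no_return (T : finType) (tau : T -> T) (B : {set T}) (Q : nat) :=
  forall (y : T) (q : nat), y \in B -> 0 < q <= Q -> iter q tau y \notin B.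

Lemma iter_injective (T : Type) (f : T -> T) (n : nat) :
  injective f -> injective (iter n f).
Proof. by move=> f_inj; elim: n => //= n IHn x y /f_inj /IHn. Qed.

(** Cancelling the smaller power of [tau] in a coincidence leaves a return to [B] after at most [Q]
    steps, unless both exponents agree. The shift [m] allows any window of [Q + 1] consecutive
    times. *)
Lemma no_return_inj (T : finType) (tau : T -> T) (B : {set T}) (Q m : nat) :
  injective tau -> no_return tau B Q ->
  {in finset.setX [set: 'I_Q.+1] B &,
    injective (fun p : 'I_Q.+1 * T => iter (m + p.1) tau p.2)}.
Proof.
move=> tau_inj nrB.
have main (q q' : 'I_Q.+1) b b' : b' \in B -> b \in B -> q <= q' ->
    iter (m + q) tau b = iter (m + q') tau b' -> (q, b) = (q', b').
  move=> b'B bB le_qq'; have -> : m + q' = m + q + (q' - q) by lia.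
  rewrite [RHS]iterD => /(iter_injective tau_inj) eb.
  have [qq'|ne_qq'] := eqVneq (q' - q) 0.
    rewrite qq' /= in eb; rewrite eb; congr (_, _).
    by apply/val_inj => /=; lia.
  suff : b \notin B by rewrite bB.
  by rewrite eb nrB //; have := ltn_ord q'; lia.
move=> [q b] [q' b']; rewrite !finset.in_setX !inE /= => bB b'B.
have [le_qq'|/ltnW le_q'q] := leqP q q'; first exact: main.
by move=> /esym/main-/(_ bB b'B le_q'q)/esym.
Qed.

Lemma card_uncovered (T : finType) (tau : T -> T) (B : {set T}) (Q : nat) :
  injective tau -> no_return tau B Q ->
  #|uncovered tau B Q| = #|T| - Q.+1 * #|B|.
Proof.
move=> tau_inj nrB; rewrite /uncovered cardsCs finset.setCK card_in_imset.
  by rewrite cardsX cardsT card_ord.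
exact: (no_return_inj (m := 0) tau_inj nrB).
Qed.

(** A covered point of the orbit was in [B] at most [Q] steps earlier. This visit has time at least
    0: otherwise some point of [B] would return to [B], namely to [y], within [Q] steps. *)
Lemma uncovered_iter (T : finType) (tau : T -> T) (B : {set T}) (Q : nat)
    (y : T) (m : nat) :
  injective tau -> no_return tau B Q -> y \in B ->
  reflect (exists2 s, s <= m <= s + Q & iter s tau y \in B)
          (iter m tau y \notin uncovered tau B Q).
Proof.
move=> tau_inj nrB yB; rewrite finset.in_setC negbK; apply: (iffP imsetP).
  move=> [[q b]]; rewrite finset.in_setX inE /= => bB e.
  have [le_qm|lt_mq] := leqP q m.
    exists (m - q); first by have := ltn_ord q; lia.
    move: e; rewrite -{1}(subnKC le_qm) iterD.
    by move=> /(iter_injective tau_inj) ->.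
  move: e; rewrite -{1}(subnKC (ltnW lt_mq)) iterD.
  move=> /(iter_injective tau_inj) ey.
  suff : y \notin B by rewrite yB.
  by rewrite ey nrB //; have := ltn_ord q; lia.
move=> [s sm sB]; have lt_msQ : m - s < Q.+1 by lia.
exists (Ordinal lt_msQ, iter s tau y); first by rewrite finset.in_setX inE.
by rewrite -iterD /= subnK //; case/andP: sm.
Qed.

(** Induction on the last visit [s] before the current one. From [s] on, the first [Q + 1] times are
    covered; all later ones are uncovered, since there is no visit in between. Each gap is thus
    [Q + 1] plus its number of uncovered times. *)
Lemma return_time_uncovered (T : finType) (tau : T -> T) (B : {set T})
    (Q r : nat) (y : T) :
  injective tau -> no_return tau B Q -> y \in B -> iter r tau y \in B ->
  exists k, r = k * Q.+1
                + \sum_(0 <= m < r) (iter m tau y \in uncovered tau B Q).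
Proof.
move=> tau_inj nrB yB; elim/ltn_ind: r => -[|r] IHr rB.
  by exists 0; rewrite big_geq.
pose P s := (s <= r) && (iter s tau y \in B).
have exP : exists s, P s by exists 0; rewrite /P yB.
have ubP s : P s -> s <= r by case/andP.
case: (ex_maxnP exP ubP) => s /andP[le_sr sB] s_max.
have [k ek] := IHr s le_sr sB.
have sQr : s + Q.+1 <= r.+1.
  rewrite leqNgt; apply/negP => lt_rsQ.
  suff : iter r.+1 tau y \notin B by rewrite rB.
  rewrite -[r.+1](@subnK s) 1?ltnW // iterD.
  by apply: nrB => //; lia.
exists k.+1.
rewrite (big_cat_nat (n := s)) ?(leq_trans le_sr) //=.
rewrite (big_cat_nat (m := s) (n := s + Q.+1)) ?leq_addr //=.
rewrite [X in _ + (_ + (X + _))]big_nat_cond [X in _ + (_ + (X + _))]big1.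
  rewrite [X in _ + (_ + (_ + X))](eq_big_nat _ _ (F2 := fun=> 1)).
    by rewrite sum_nat_const_nat; lia.
  move=> m /andP[sQm mr]; apply/eqP; rewrite eqb1.
  apply/negPn/negP => /(uncovered_iter m tau_inj nrB yB)[t tm tB].
  have := s_max t; rewrite /P tB andbT.
  by case: leqP; lia.
move=> m; rewrite andbT => sm; apply/eqP; rewrite eqb0.
by apply/(uncovered_iter m tau_inj nrB yB); exists s => //; lia.
Qed.

Lemma big_nat_block (F : nat -> nat) (K n : nat) :
  \sum_(K * n <= m < K.+1 * n) F m = \sum_(q < n) F (q + K * n).
Proof. by rewrite mulSn -{1}[K * n]add0n big_addn addnK big_mkord. Qed.

(** The time interval is cut into [K] blocks of length [Q + 1]. Within one block, distinct pairs of
    a time and a point of [X] reach distinct points, so each uncovered point is counted at most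
    once. *)
Lemma sum_uncovered_le (T : finType) (tau : T -> T) (B X : {set T})
    (Q r K : nat) :
  injective tau -> no_return tau B Q -> X \subset B -> r <= K * Q.+1 ->
  \sum_(y in X) \sum_(0 <= m < r) (iter m tau y \in uncovered tau B Q)
    <= K * #|uncovered tau B Q|.
Proof.
move=> tau_inj nrB XB le_r.
set U := uncovered tau B Q.
apply: (@leq_trans (\sum_(y in X) \sum_(0 <= m < K * Q.+1)
                      (iter m tau y \in U))).
  apply: leq_sum => y _.
  by rewrite [leqRHS](big_cat_nat (n := r)) //= leq_addr.
elim: K {r le_r} => [|K IHK].
  by rewrite mul0n big1 // => y _; rewrite big_geq.
under eq_bigr => y _.
  rewrite (big_cat_nat (n := K * Q.+1)) //=; last by rewrite leq_mul2r leqnSn orbT.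
  over.
rewrite big_split [leqRHS]mulSnr leq_add //=.
under eq_bigr => y _ do rewrite big_nat_block.
pose D := [set p in finset.setX [set: 'I_Q.+1] X |
             iter (K * Q.+1 + p.1) tau p.2 \in U].
have -> : \sum_(y in X) \sum_(q < Q.+1) (iter (q + K * Q.+1) tau y \in U) = #|D|.
  rewrite -sum1_card exchange_big pair_big_dep /= big_mkcond [RHS]big_mkcond.
  apply: eq_bigr => -[q y] _ /=; rewrite !inE /= addnC.
  by case: (y \in X) => //=; case: (_ \in U).
rewrite -(@card_in_imset _ _ (fun p : 'I_Q.+1 * T => iter (K * Q.+1 + p.1) tau p.2)).
  apply: subset_leq_card; apply/fintype.subsetP => z /imsetP[p pD ->].
  by move: pD; rewrite inE => /andP[].
move=> p p' /setIdP[pX _] /setIdP[p'X _].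
have sub : {subset finset.setX [set: 'I_Q.+1] X <= finset.setX [set: 'I_Q.+1] B}.
  by apply/fintype.subsetP; rewrite finset.setXS.
by apply: (no_return_inj tau_inj nrB); apply: sub.
Qed.

(** Averaging: the point of [X] whose orbit meets the uncovered set least often does so at most the
    mean number of times. *)
Lemma return_time_decomp (T : finType) (tau : T -> T) (B X : {set T})
    (Q r K : nat) :
  injective tau -> no_return tau B Q -> X \subset B ->
  (forall y, y \in X -> iter r tau y \in B) -> X != finset.set0 -> r <= K * Q.+1 ->
  exists k f, r = k * Q.+1 + f /\ f * #|X| <= K * (#|T| - Q.+1 * #|B|).
Proof.
move=> tau_inj nrB XB XrB /finset.set0Pn[x0 x0X] le_r.
pose f y := \sum_(0 <= m < r) (iter m tau y \in uncovered tau B Q).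
have [y yX y_min] := arg_minnP f x0X.
have yB := fintype.subsetP XB _ yX.
have [k ek] := return_time_uncovered tau_inj nrB yB (XrB _ yX).
exists k, (f y); split=> //.
rewrite -(card_uncovered tau_inj nrB).
apply: leq_trans (sum_uncovered_le tau_inj nrB XB le_r).
by rewrite mulnC -sum_nat_const; apply: leq_sum.
Qed.

Local Open Scope ring_scope.

(** * Rotations of a discretized torus *)

Definition ibox (I : finType) (N : nat) (t L : I -> nat) :
    {set {ffun I -> 'I_N.+1}} :=
  [set y : {ffun I -> 'I_N.+1} | [forall j, (t j <= y j < t j + L j)%N]].

Lemma card_ibox (I : finType) (N : nat) (t L : I -> nat) :
  (forall j, (t j + L j <= N.+1)%N) ->
  #|ibox N t L| = (\prod_j L j)%N.
Proof.
move=> tL; rewrite cardsE.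
transitivity #|family (fun j => [pred y : 'I_N.+1 | (t j <= y < t j + L j)%N])|.
  by apply: eq_card => y; rewrite !inE; apply/eq_forallb => j; rewrite inE.
rewrite card_family foldrE big_map big_enum /=; apply: eq_bigr => j _.
rewrite -sum1_card.
rewrite -(big_mkord (fun y => (t j <= y < t j + L j)%N) (fun=> 1%N)).
transitivity (\sum_(t j <= y < t j + L j) 1)%N; last first.
  by rewrite sum_nat_const_nat addKn muln1.
rewrite (big_nat_widenl (t j) 0) // (big_nat_widen 0 (t j + L j) N.+1) //.
Qed.

Definition torus_rot (I : finType) (N : nat) (a : I -> int)
    (y : {ffun I -> 'I_N.+1}) : {ffun I -> 'I_N.+1} :=
  [ffun j => inord `|(((y j)%:Z + a j) %% N.+1%:Z)%Z|%N].

Lemma torus_rotE (I : finType) (N : nat) (a : I -> int) (y : {ffun I -> 'I_N.+1})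
    (j : I) :
  (torus_rot a y j)%:Z = (((y j)%:Z + a j) %% N.+1%:Z)%Z.
Proof.
have ge0 : (0 <= ((y j)%:Z + a j) %% N.+1%:Z)%Z by rewrite modz_ge0.
have lt_N : (((y j)%:Z + a j) %% N.+1%:Z)%Z < N.+1%:Z by rewrite ltz_pmod.
by rewrite ffunE inordK; lia.
Qed.

Lemma iter_torus_rotE (I : finType) (N : nat) (a : I -> int)
    (y : {ffun I -> 'I_N.+1}) (q : nat) (j : I) :
  (iter q (torus_rot a) y j)%:Z = (((y j)%:Z + q%:Z * a j) %% N.+1%:Z)%Z.
Proof.
elim: q => [|q IHq]; first by rewrite mul0r addr0 modz_nat modn_small.
by rewrite iterS torus_rotE IHq modzDml -addrA -[q.+1]addn1 PoszD mulrDl mul1r.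
Qed.

Lemma torus_rot_inj (I : finType) (N : nat) (a : I -> int) :
  injective (@torus_rot I N a).
Proof.
move=> y z e; apply/ffunP => j; apply/val_inj/eqP; rewrite -eqz_nat /=.
have := congr1 (fun x : {ffun I -> 'I_N.+1} => (x j)%:Z) e.
rewrite /= !torus_rotE => /eqP; rewrite eqz_modDr.
by rewrite !modz_nat !modn_small.
Qed.

(** Pigeonhole: the fractional parts of the [P + 1] multiples [q * x], [0 <= q <= P], fall into [P]
    cells of sides [1 / N j]. *)
Lemma simultaneous_dirichlet (R : realType) (I : finType) (N : I -> nat)
    (x : I -> R) :
  (forall j, (0 < N j)%N) ->
  exists2 q : nat, (0 < q <= \prod_j N j)%N &
    forall j, exists p : int, `|q%:R * x j - p%:~R| < (N j)%:R^-1.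
Proof.
move=> N_gt0; set P := (\prod_j N j)%N.
have leNP j : (N j <= P)%N.
  by rewrite /P (bigD1 j) //= leq_pmulr // prodn_gt0.
pose fr (q : nat) j := q%:R * x j - (Num.floor (q%:R * x j))%:~R.
have fr_itv q j : 0 <= fr q j < 1.
  rewrite subr_ge0 floor_le /= ltrBlDl.
  by have := floorD1_gt (q%:R * x j); rewrite intrD addrC.
pose cell q j := Num.truncn ((N j)%:R * fr q j).
have cell_itv q j : (cell q j)%:R <= (N j)%:R * fr q j < (cell q j).+1%:R.
  by apply: truncn_itv; rewrite mulr_ge0 //; case/andP: (fr_itv q j).
have lt_cell q j : (cell q j < N j)%N.
  have /andP[le_c _] := cell_itv q j.
  rewrite -(ltr_nat R); apply: le_lt_trans le_c _.
  by rewrite gtr_pMr ?ltr0n //; case/andP: (fr_itv q j).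
(* Cells are encoded as points of a grid of side [P + 1], so that [card_ibox] counts them; [inord]
   is faithful because [cell q j < N j <= P]. *)
pose f (q : 'I_P.+1) : {ffun I -> 'I_P.+1} := [ffun j => inord (cell q j)].
have f_box q : f q \in ibox P (fun=> 0%N) N.
  rewrite inE; apply/forallP => j; rewrite add0n ffunE inordK ?lt_cell //.
  by rewrite ltnS ltnW // (leq_trans (lt_cell _ _)).
have /injectivePn[q [q' ne_qq' e]] : ~~ injectiveb f.
  apply/negP => /injectiveP f_inj.
  have : (#|[set f q | q : 'I_P.+1]%SET| <= #|ibox P (fun=> 0%N) N|)%N.
    by apply/subset_leq_card/fintype.subsetP => _ /imsetP[q _ ->].
  rewrite card_imset // card_ord card_ibox ?ltnn // => j.
  by rewrite add0n ltnW // ltnS.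
wlog lt_qq' : q q' ne_qq' e / (q < q')%N.
  move=> wl; have : (q < q')%N || (q' < q)%N by rewrite -neq_ltn.
  by case/orP; apply: wl => //; rewrite eq_sym.
exists (q' - q)%N.
  by rewrite subn_gt0 lt_qq' (leq_trans (leq_subr _ _)) // -ltnS ltn_ord.
move=> j; exists (Num.floor (q'%:R * x j) - Num.floor (q%:R * x j)).
have ec : cell q j = cell q' j.
  have := congr1 (fun y : {ffun I -> 'I_P.+1} => val (y j)) e.
  by rewrite /= !ffunE !inordK //
     ltnS ltnW // (leq_trans (lt_cell _ _)).
rewrite natrB ?(ltnW lt_qq') // intrB.
have -> : (q'%:R - q%:R) * x j -
   ((Num.floor (q'%:R * x j))%:~R - (Num.floor (q%:R * x j))%:~R)
   = fr q' j - fr q j by rewrite /fr; ring.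
have Nj : 0 < (N j)%:R :> R by rewrite ltr0n.
rewrite -(ltr_pM2l Nj) mulfV ?gt_eqF // -[X in X * _]gtr0_norm // -normrM.
have := cell_itv q j; have := cell_itv q' j; rewrite ec -natr1.
by move=> /andP[? ?] /andP[? ?]; rewrite ltr_norml mulrBr; lra.
Qed.

Lemma bernoulli_sub (R : realDomainType) (x : R) (n : nat) :
  0 <= x <= 1 -> 1 - n%:R * x <= (1 - x) ^+ n.
Proof.
move=> /andP[x0 x1]; elim: n => [|n IHn]; first by rewrite mul0r subr0.
rewrite exprS; apply: (@le_trans _ _ ((1 - x) * (1 - n%:R * x))).
  have : 0 <= n%:R * x ^+ 2 by rewrite mulr_ge0 ?sqr_ge0.
  by rewrite -natr1; lra.
by rewrite ler_wpM2l // subr_ge0.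
Qed.

(** Both points have [j]-th coordinate in [[0, L j)], and the difference of these coordinates is
    congruent to [q * a j] modulo [N + 1]. *)
Lemma torus_rot_return (I : finType) (N : nat) (a : I -> int) (L : I -> nat)
    (y : {ffun I -> 'I_N.+1}) (q : nat) (j : I) :
  y \in ibox N (fun=> 0%N) L -> iter q (torus_rot a) y \in ibox N (fun=> 0%N) L ->
  exists p : int, `|q%:Z * a j - p * N.+1%:Z| < (L j)%:Z.
Proof.
rewrite !inE => /forallP/(_ j) yL /forallP/(_ j) zL.
have e := iter_torus_rotE a y q j.
have := divz_eq ((y j)%:Z + q%:Z * a j) N.+1%:Z; rewrite -e.
set p := (_ %/ _)%Z => ep; exists p; lia.
Qed.

(** Here [s] is the signed displacement after [r] steps. Starting the small box at [max (- s j) 0]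
    keeps [y j + s j] nonnegative, and the room [|s j| + h j <= L j] keeps it below [L j], so no
    reduction modulo [N + 1] occurs. *)
Lemma iter_torus_rot_ibox (I : finType) (N : nat) (a s : I -> int) (h L : I -> nat)
    (r : nat) (y : {ffun I -> 'I_N.+1}) :
  (forall j, exists p : int, s j = r%:Z * a j - p * N.+1%:Z) ->
  (forall j, (`|s j| + h j <= L j <= N.+1)%N) ->
  y \in ibox N (fun j => `|Num.min (s j) 0|%N) h ->
  y \in ibox N (fun=> 0%N) L /\ iter r (torus_rot a) y \in ibox N (fun=> 0%N) L.
Proof.
move=> sP shL; rewrite !inE => /forallP yh; split; apply/forallP => j.
  by have := yh j; have := shL j; rewrite add0n; lia.
have [p ep] := sP j.
have := iter_torus_rotE a y r j.
have -> : (y j)%:Z + r%:Z * a j = p * N.+1%:Z + ((y j)%:Z + s j) by lia.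
rewrite modzMDl modz_small; first by have := yh j; have := shL j; lia.
by have := yh j; have := shL j; lia.
Qed.

(** * Good denominators are nearly multiples of [Q + 1] *)

Lemma exists_scale (R : realType) (I : finType) (l : I -> R) (b : R) :
  (forall j, 0 < l j) -> 0 <= b ->
  exists N : nat, forall j, b <= l j * N.+1%:R.
Proof.
move=> l0 b0; exists (Num.truncn (\sum_j b / l j)) => j.
rewrite -ler_pdivrMl // mulrC; apply: le_trans (ltW (truncnS_gt _)).
rewrite (bigD1 j) //= lerDl sumr_ge0 // => k _.
by rewrite divr_ge0 // ltW.
Qed.

(** [return_time_decomp] is applied to a box [B] of sides about [(1 - kappa) * l j] and a smaller
    box [X] of sides about [l j / 4], which stays in [B] after [r] steps. With [d = #|I|], [B]
    leaves uncovered a proportion at most [2 d kappa] of the torus, while [X] has proportion at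
    least [4^(-d) / Q]; the quotient bounds [f]. *)
Lemma near_multiple (R : realType) (I : finType) (l x : I -> R)
    (Q r K : nat) (kappa : R) :
  (0 < Q)%N -> 0 < kappa <= 10^-1 ->
  (forall j, 0 < l j <= 1) -> \prod_j l j = Q%:R^-1 ->
  (forall q, (0 < q <= Q)%N ->
    exists j, forall p : int, (1 - kappa) * l j <= `|q%:R * x j - p%:~R|) ->
  (forall j, exists p : int, `|r%:R * x j - p%:~R| <= l j / 4) ->
  (r <= K * Q)%N ->
  exists k f, r = (k * Q.+1 + f)%N /\
    f%:R <= kappa * ((2 * #|I|)%:R * 4 ^+ #|I| * K%:R) * Q%:R.
Proof.
move=> Q0 /andP[k0 k10] l01 prodl nosol rnear le_r.
have l0 j : 0 < l j by case/andP: (l01 j).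
have l1 j : l j <= 1 by case/andP: (l01 j).
have Q0R : 0 < Q%:R :> R by rewrite ltr0n.
have [pr rpr] := choice rnear.
(* The first term makes the rounding loss [Q + 1] at most [kappa * l j * M / 2]; the second makes
   [r + 1] at most [l j * M / 4]. *)
pose b : R := 2 * Q.+1%:R / kappa + 4 * r.+1%:R.
have [N Nb] : exists N : nat, forall j, b <= l j * N.+1%:R.
  by apply: exists_scale => //; rewrite addr_ge0 ?divr_ge0 ?mulr_ge0 // ltW.
set M : R := N.+1%:R.
have M0 : 0 < M by rewrite ltr0n.
have lMQ j : 2 * Q.+1%:R <= kappa * (l j * M).
  rewrite [leRHS]mulrC -ler_pdivrMr //; apply: le_trans (Nb j).
  by rewrite lerDl mulr_ge0.
have lMr j : 4 * r.+1%:R <= l j * M.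
  apply: le_trans (Nb j).
  by rewrite lerDr divr_ge0 ?mulr_ge0 // ltW.
have lM_le j : l j * M <= M by rewrite ger_pMl.
have lM0 j : 0 < l j * M by rewrite mulr_gt0.
have lM_ge0 j : 0 <= l j * M by exact: ltW.
have k_ge0 : 0 <= kappa by exact: ltW.
have k10_ge0 : 0 <= 10^-1 - kappa by rewrite subr_ge0.
pose a j : int := Num.floor (M * x j).
have a_itv j : 0 <= M * x j - (a j)%:~R < 1.
  have /andP[af fa] := floor_itv (M * x j).
  by move: af fa; rewrite -/(a j) intrD /=; lra.
pose L0 j := Num.truncn ((1 - kappa) * (l j * M)).
have L0_itv j : (L0 j)%:R <= (1 - kappa) * (l j * M) < (L0 j)%:R + 1.
  by rewrite natr1; apply: truncn_itv; rewrite mulr_ge0 ?(ltW (lM0 _)) //; lra.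
have leQL0 j : (Q <= L0 j)%N.
  rewrite -ltnS -(ltr_nat R) -natr1.
  have /andP[_ lt] := L0_itv j; apply: le_lt_trans lt.
  have := lMQ j; have := lM0 j; have : (0 : R) <= Q.+1%:R by [].
  rewrite -natr1 => q0 lM0' lMQ'.
  have : 0 <= (10^-1 - kappa) * (l j * M) by rewrite mulr_ge0.
  by lra.
(* The margin Q absorbs the error q (M x_j - a_j) < Q of the discretization. *)
pose L j := (L0 j - Q)%N.
have L_le j : (L j)%:R + Q%:R <= (1 - kappa) * (l j * M).
  by rewrite -natrD subnK //; case/andP: (L0_itv j).
have L_ge j : (1 - kappa) ^+ 2 * (l j * M) <= (L j)%:R.
  have : (L j)%:R + Q%:R = (L0 j)%:R :> R by rewrite -natrD subnK.
  have /andP[_] := L0_itv j.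
  have := lMQ j; rewrite -[Q.+1%:R]natr1.
  have : 0 <= kappa * (10^-1 - kappa) * (l j * M).
    by rewrite mulr_ge0 ?(mulr_ge0 k_ge0).
  have : 0 <= kappa * (l j * M) by rewrite mulr_ge0.
  have : 0 <= Q%:R :> R by [].
  by lra.
have LN j : (L j <= N.+1)%N.
  rewrite -(ler_nat R) -/M.
  have := L_le j; have : (0 : R) <= Q%:R by [].
  have : 0 <= kappa * (l j * M) by rewrite mulr_ge0.
  have := lM_le j; lra.
pose h j := (Num.truncn (l j * M / 4)).+1.
have h_itv j : l j * M / 4 <= (h j)%:R <= l j * M / 4 + 1.
  have /andP[hl hr] : (Num.truncn (l j * M / 4))%:R <= l j * M / 4 < (h j)%:R.
    by apply: truncn_itv; rewrite divr_ge0 // ltW.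
  by rewrite (ltW hr) /h -natr1 lerD2r.
(* This lifts [M * (r x_j - pr j)] to the grid, with an error at most [r]. *)
pose s j : int := r%:Z * a j - pr j * N.+1%:Z.
have s_le j : (`|s j|%N)%:R <= l j * M / 4 + r%:R.
  rewrite natr_absz intr_norm /s intrB !intrM -!pmulrn -/M.
  have -> : r%:R * (a j)%:~R - (pr j)%:~R * M
     = M * (r%:R * x j - (pr j)%:~R) - r%:R * (M * x j - (a j)%:~R) by ring.
  apply: le_trans (ler_normB _ _) _; rewrite !normrM lerD //.
    by rewrite gtr0_norm // mulrAC [leRHS]mulrC ler_wpM2l ?(ltW M0).
  have /andP[u0 u1] := a_itv j.
  by rewrite !ger0_norm // ler_piMr // ltW.
(* The left side is at most [3/4 * l j * M], and [(1 - kappa)^2 >= 3/4] because [kappa <= 1/10]. *)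
have shL j : (`|s j| + h j <= L j <= N.+1)%N.
  rewrite LN andbT -(ler_nat R) natrD; apply: le_trans (L_ge j).
  have /andP[_ h1] := h_itv j.
  have := s_le j; have := lMr j; rewrite -[r.+1%:R]natr1.
  have : 0 <= (10^-1 - kappa) * (l j * M) by rewrite mulr_ge0.
  have : 0 <= kappa ^+ 2 * (l j * M) by rewrite mulr_ge0 ?sqr_ge0.
  by have := lM_ge0 j; lra.
pose B := ibox N (fun=> 0%N) L.
pose X := ibox N (fun j => `|Num.min (s j) 0|%N) h.
have XB y : y \in X -> y \in B /\ iter r (torus_rot a) y \in B.
  by apply: iter_torus_rot_ibox => // j; exists (pr j).
have nrB : no_return (torus_rot a) B Q.
  move=> y q yB qQ; apply/negP => zB.
  have [j jp] := nosol q qQ.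
  have [p pL] := torus_rot_return j yB zB.
  have := jp p; rewrite leNgt => /negP; apply.
  rewrite -(ltr_pM2l M0) -[X in X * _]gtr0_norm // -normrM.
  have -> : M * (q%:R * x j - p%:~R)
     = (q%:Z * a j - p * N.+1%:Z)%:~R + q%:R * (M * x j - (a j)%:~R).
    by rewrite intrB !intrM -!pmulrn -/M; ring.
  apply: le_lt_trans (ler_normD _ _) _.
  have : `|(q%:Z * a j - p * N.+1%:Z)%:~R| < (L j)%:R :> R.
    by rewrite -intr_norm -(ltr_int R) in pL *.
  have /andP[u0 u1] := a_itv j.
  have : `|q%:R * (M * x j - (a j)%:~R)| <= Q%:R.
    rewrite normrM !ger0_norm //.
    apply: (@le_trans _ _ q%:R); first by rewrite ler_piMr // ltW.
    by rewrite ler_nat; case/andP: qQ.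
  by have := L_le j; lra.
have cardX : #|X| = (\prod_j h j)%N.
  by rewrite card_ibox // => j; have := shL j; lia.
have cardB : #|B| = (\prod_j L j)%N.
  by rewrite card_ibox // => j; rewrite add0n.
have [] := @return_time_decomp _ (torus_rot a) B X Q r K.
- exact: torus_rot_inj.
- exact: nrB.
- by apply/fintype.subsetP => y /XB[].
- by move=> y /XB[].
- by rewrite -card_gt0 cardX prodn_gt0.
- by apply: leq_trans le_r _; rewrite leq_mul2l leqnSn orbT.
move=> k [f [rkf fX]]; exists k, f; split=> //.
move: fX; rewrite cardX cardB card_ffun card_ord -(ler_nat R) !natrM => fX.
set d := #|I| in fX *.
have prodlM : \prod_j (l j * M) = M ^+ d / Q%:R.
  by rewrite big_split /= prodl prodr_const mulrC.
have prodh : M ^+ d / Q%:R / 4 ^+ d <= (\prod_j h j)%:R.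
  rewrite -prodlM -exprVn -prodr_const -big_split /= natr_prod.
  apply: ler_prod => j _; rewrite divr_ge0 ?(ltW (lM0 j)) //=.
  by case/andP: (h_itv j).
(* Each side loses a factor [1 - kappa] twice, once by hypothesis and once by rounding, hence the
   exponent [2 * d] in Bernoulli's inequality. *)
have prodL : (1 - (2 * d)%:R * kappa) * (M ^+ d / Q%:R) <= (\prod_j L j)%:R.
  apply: (@le_trans _ _ ((1 - kappa) ^+ (2 * d) * (M ^+ d / Q%:R))).
    rewrite ler_wpM2r ?divr_ge0 ?exprn_ge0 ?(ltW M0) //.
    by apply: bernoulli_sub; apply/andP; split; lra.
  rewrite -prodlM exprM -prodr_const -big_split /= natr_prod.
  apply: ler_prod => j _; rewrite L_ge andbT.
  by rewrite mulr_ge0 ?sqr_ge0 ?(ltW (lM0 j)).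
have Md0 : 0 < M ^+ d by rewrite exprn_gt0.
have sub_le : (N.+1 ^ d - Q.+1 * \prod_j L j)%:R <= (2 * d)%:R * kappa * M ^+ d.
  (* Subtraction in [nat] truncates at 0, which settles the second case. *)
  have [le|lt] := leqP (Q.+1 * \prod_j L j) (N.+1 ^ d); last first.
    by rewrite (eqP (ltnW lt)) !mulr_ge0 ?exprn_ge0 ?(ltW M0).
  rewrite natrB // natrX -/M natrM.
  have : Q%:R * ((1 - (2 * d)%:R * kappa) * (M ^+ d / Q%:R))
       <= Q.+1%:R * (\prod_j L j)%:R.
    apply: (@le_trans _ _ (Q%:R * (\prod_j L j)%:R)).
      by rewrite ler_wpM2l.
    by rewrite ler_wpM2r // ler_nat.
  rewrite mulrCA (mulrCA Q%:R) divff ?gt_eqF // mulr1; lra.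
have fM : f%:R * (M ^+ d / Q%:R / 4 ^+ d) <= K%:R * ((2 * d)%:R * kappa * M ^+ d).
  apply: (@le_trans _ _ (f%:R * (\prod_j h j)%:R)); first by rewrite ler_wpM2l.
  by apply: le_trans fX _; rewrite ler_wpM2l.
have P0 : 0 < M ^+ d / Q%:R / 4 ^+ d by rewrite !divr_gt0 ?exprn_gt0.
rewrite -(ler_pM2r P0); apply: le_trans fM _.
rewrite le_eqVlt; apply/orP; left; apply/eqP.
by field; rewrite !gt_eqF // exprn_gt0.
Qed.

(** * Weighted approximation *)

Lemma prod_powR (R : realType) (I : finType) (a : R) (w : I -> R) :
  0 < a -> \prod_j a `^ w j = a `^ \sum_j w j.
Proof.
move=> a0; apply/esym/(big_morph (powR a)); last exact: powRr0.
by move=> r s; rewrite powRD //; apply/implyP => _; rewrite gt_eqF.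
Qed.

Lemma le1_of_sum (R : numDomainType) (I : finType) (w : I -> R) (j : I) :
  (forall k, 0 <= w k) -> \sum_k w k = 1 -> w j <= 1.
Proof.
by move=> w0 <-; rewrite (bigD1 j) //= lerDl sumr_ge0.
Qed.

Lemma weighted_dirichlet (R : realType) (I : finType) (w x : I -> R)
    (N Q : nat) :
  (0 < N)%N -> (0 < Q)%N -> (forall j, 0 <= w j) -> \sum_j w j = 1 ->
  exists2 q : nat, (0 < q <= (2 * N) ^ #|I| * Q)%N &
    forall j, exists p : int,
      `|q%:R * x j - p%:~R| < Q%:R `^ (- w j) / N%:R.
Proof.
move=> N0 Q0 w0 w1.
have Q0R : 0 < Q%:R :> R by rewrite ltr0n.
have N1R : 1 <= N%:R :> R by rewrite ler1n.
have Qw1 j : 1 <= Q%:R `^ w j by rewrite -[leLHS](powRr0 Q%:R) ler_powR ?ler1n.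
have NQw1 j : 1 <= N%:R * Q%:R `^ w j by rewrite mulr_ege1.
(* Rounding up at most doubles [N * Q^(w j) >= 1], and the product of the doubled numbers is
   [(2N)^#|I| * Q]. *)
pose n j := (Num.truncn (N%:R * Q%:R `^ w j)).+1.
have n_itv j : N%:R * Q%:R `^ w j < (n j)%:R <= 2 * N%:R * Q%:R `^ w j.
  have /andP[tl tr] := truncn_itv (le_trans ler01 (NQw1 j)).
  rewrite tr /= /n -natr1 -mulrA; have := NQw1 j; lra.
have [//|q /andP[q0 qn] qx] := simultaneous_dirichlet x (N := n).
have prodQ : \prod_j Q%:R `^ w j = Q%:R.
  by rewrite prod_powR // w1 powRr1.
exists q.
  rewrite q0 (leq_trans qn) // -(ler_nat R) natr_prod natrM natrX natrM.
  rewrite -[X in _ * X]prodQ -prodr_const -big_split /=.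
  by apply: ler_prod => j _; rewrite ler0n; case/andP: (n_itv j).
move=> j; have [p lt_p] := qx j; exists p; apply: lt_trans lt_p _.
rewrite powRN -invfM ltf_pV2 ?posrE ?ltr0n //.
  by rewrite mulrC; case/andP: (n_itv j).
by rewrite mulr_gt0 ?powR_gt0 // (lt_le_trans ltr01).
Qed.

(** A factor [t^n] gained on a denominator yields a factor [t] on its power [w]; one [n] serves all
    the positive weights at once. *)
Lemma powR_scale_le (R : realType) (t y w : R) (n : nat) :
  0 < t <= 1 -> 0 <= y -> 1 <= w * n%:R -> 
  (t ^+ n * y) `^ w <= t * y `^ w.
Proof.
move=> t01 y0 wn; have t0 : 0 <= t by case/andP: t01 => /ltW.
rewrite powRM ?exprn_ge0 // ler_wpM2r ?powR_ge0 //.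
rewrite -powR_mulrn // -powRrM.
by rewrite -[leRHS](powRr1 t0) ger_powR // mulrC.
Qed.

Lemma powR_scale_ge (R : realType) (t y w : R) (n : nat) :
  1 <= t -> 0 <= w -> 1 <= w * n%:R -> t ^+ n <= y -> t <= y `^ w.
Proof.
move=> t1 w0 wn ty; have t0 : 0 <= t by apply: le_trans t1.
apply: (@le_trans _ _ ((t ^+ n) `^ w)).
  by rewrite -powR_mulrn // -powRrM -[leLHS](powRr1 t0) ler_powR // mulrC.
by rewrite ge0_ler_powR // nnegrE ?exprn_ge0 // (le_trans _ ty) ?exprn_ge0.
Qed.

Definition approximable (R : realType) (I : finType) (l x : I -> R) (q : nat) :=
  forall j, exists p : int, `|q%:R * x j - p%:~R| < l j.

Lemma near_multiple_dirichlet (R : realType) (I : finType) (w x : I -> R)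
    (N Q : nat) (kappa : R) (K := ((2 * N) ^ #|I|)%N)
    (A := (2 * #|I|)%:R * 4 ^+ #|I| * K%:R : R) :
  (4 <= N)%N -> (0 < Q)%N -> (forall j, 0 <= w j) -> \sum_j w j = 1 ->
  0 < kappa <= 10^-1 -> kappa * A < 1 ->
  (forall q, (0 < q <= Q)%N ->
    ~ approximable (fun j => (1 - kappa) * Q%:R `^ (- w j)) x q) ->
  exists a f : nat, [/\ (0 < a <= K)%N, (a * Q.+1 + f <= K * Q)%N,
    f%:R <= kappa * A * Q%:R &
    approximable (fun j => Q%:R `^ (- w j) / N%:R) x (a * Q.+1 + f)].
Proof.
move=> N4 Q0 w0 w1 k01 kA nosol.
have N0 : (0 < N)%N by apply: leq_trans N4.
have Q0R : 0 < Q%:R :> R by rewrite ltr0n.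
have l0 j : 0 < Q%:R `^ (- w j) by rewrite powR_gt0.
have leN4 j : Q%:R `^ (- w j) / N%:R <= Q%:R `^ (- w j) / 4.
  by rewrite ler_wpM2l ?(ltW (l0 j)) // lef_pV2 ?posrE ?ltr0n // ler_nat.
have [q /andP[q0 qK] qx] := weighted_dirichlet x N0 Q0 w0 w1.
have [|||||a [f [qaf fA]]] :=
  @near_multiple R I (fun j => Q%:R `^ (- w j)) x Q q K kappa Q0 k01.
- move=> j; rewrite l0 -[leRHS](powRr0 Q%:R) /= ler_powR ?ler1n //.
  by rewrite oppr_le0.
- by rewrite prod_powR // sumrN w1 powR_inv1.
- move=> q' /nosol napp; apply: contrapT => /forallNP/= none; apply: napp => j.
  have /existsNP[p /negP] := none j.
  by rewrite -ltNge; exists p.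
- by move=> j; have [p /ltW px] := qx j; exists p; apply: le_trans px _.
- by [].
exists a, f; rewrite -qaf; split=> //.
apply/andP; split; last first.
  rewrite -(leq_pmul2r Q0); apply: leq_trans qK.
  by rewrite qaf; nia.
(* If [a = 0], then [q = f <= Q] would itself be a forbidden solution, as [1/4 < 1 - kappa]. *)
rewrite lt0n; apply/eqP => a0; move: qaf; rewrite a0 mul0n add0n => qf.
have qQ : (0 < q <= Q)%N.
  rewrite q0 -(ler_nat R) qf; apply: le_trans fA _.
  by rewrite -/A ler_piMl // ltW.
apply: (nosol q qQ) => j; have [p px] := qx j; exists p.
apply: lt_le_trans px _; apply: le_trans (leN4 j) _.
rewrite [leRHS]mulrC ler_wpM2l ?(ltW (l0 j)) //.
by case/andP: k01 => *; lra.
Qed.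

(** * Positive weights: combining two near multiples of [Q + 1] *)

Lemma combination_approx (R : realFieldType) (y1 y2 e1 e2 : R) (p1 p2 : int)
    (a b : nat) :
  `|y1 - p1%:~R| <= e1 -> `|y2 - p2%:~R| <= e2 ->
  `|(b%:R * y1 - a%:R * y2) - (b%:Z * p1 - a%:Z * p2)%:~R|
    <= b%:R * e1 + a%:R * e2.
Proof.
move=> h1 h2; rewrite intrB !intrM -!pmulrn.
have -> : b%:R * y1 - a%:R * y2 - (b%:R * p1%:~R - a%:R * p2%:~R)
  = b%:R * (y1 - p1%:~R) - a%:R * (y2 - p2%:~R) by ring.
apply: le_trans (ler_normB _ _) _.
by rewrite !normrM !normr_nat lerD // ler_wpM2l.
Qed.

(** The integer [b * p1 - a * p2] has absolute value below 1, so it vanishes and the two errors are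
    proportional as well. *)
Lemma approx_of_proportional (R : realFieldType) (y1 y2 e1 e2 : R) (p1 p2 : int)
    (a b : nat) :
  (0 < b)%N -> b%:R * y1 = a%:R * y2 ->
  `|y1 - p1%:~R| <= e1 -> `|y2 - p2%:~R| <= e2 -> b%:R * e1 + a%:R * e2 < 1 ->
  `|y1 - p1%:~R| <= a%:R * e2.
Proof.
move=> b0 e h1 h2 lt1.
have := combination_approx a b h1 h2.
rewrite e subrr sub0r normrN -intr_norm => /le_lt_trans/(_ lt1).
rewrite ltrz1 => p0.
have ep : b%:R * p1%:~R = a%:R * p2%:~R :> R.
  have : b%:Z * p1 = a%:Z * p2 by lia.
  by move/(congr1 (fun z : int => z%:~R : R)); rewrite !intrM -!pmulrn.
apply: (@le_trans _ _ (b%:R * `|y1 - p1%:~R|)).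
  by rewrite ler_peMl // ler1n.
rewrite -[X in X * _]normr_nat -normrM mulrBr e ep -mulrBr normrM normr_nat.
by rewrite ler_wpM2l.
Qed.

Lemma bad_positive_weights_improvable (R : realType) (I : finType)
    (w x : I -> R) (eps : R) :
  (forall j, 0 < w j) -> \sum_j w j = 1 -> 0 < eps ->
  (forall q, (0 < q)%N ->
    exists j, forall p : int, eps <= q%:R `^ w j * `|q%:R * x j - p%:~R|) ->
  exists2 c : R, 0 < c < 1 &
    exists Q0, forall Q, (Q0 <= Q)%N -> exists2 q, (0 < q <= Q)%N &
      approximable (fun j => c * Q%:R `^ (- w j)) x q.
Proof.
move=> w0 w1 eps0 bad.
have w_ge0 j : 0 <= w j by exact: ltW.
have w_le1 j : w j <= 1 by exact: le1_of_sum.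
pose K1 := ((2 * 4) ^ #|I|)%N.
have K1_ge1 : 1 <= K1%:R :> R by rewrite ler1n expn_gt0.
(* Chosen so that [K1^2 / N < eps], the contradiction in the proportional case. *)
pose N := (4 + Num.truncn (K1%:R ^+ 2 / eps))%N.
have N4 : (4 <= N)%N by rewrite leq_addr.
have N0 : (0 < N)%N by apply: leq_trans N4.
have N0R : 0 < N%:R :> R by rewrite ltr0n.
have NK : K1%:R ^+ 2 / N%:R < eps.
  rewrite ltr_pdivrMr // mulrC -ltr_pdivrMr //.
  by apply: lt_le_trans (truncnS_gt _) _; rewrite ler_nat -add1n leq_add2r.
pose K2 := ((2 * N) ^ #|I|)%N.
have K2_ge1 : 1 <= K2%:R :> R.
  by rewrite ler1n expn_gt0 muln_gt0 N0.
pose A1 : R := (2 * #|I|)%:R * 4 ^+ #|I| * K1%:R.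
pose A2 : R := (2 * #|I|)%:R * 4 ^+ #|I| * K2%:R.
have K12 : 0 < K1%:R + K2%:R :> R by rewrite ltr_pwDl // (lt_le_trans ltr01).
have A1_ge0 : 0 <= A1 by rewrite !mulr_ge0 ?exprn_ge0.
have A2_ge0 : 0 <= A2 by rewrite !mulr_ge0 ?exprn_ge0.
pose A := K2%:R * A1 + K1%:R * A2 + 1.
have KA1 : A1 <= K2%:R * A1 by rewrite ler_peMl.
have KA2 : A2 <= K1%:R * A2 by rewrite ler_peMl.
have A0 : 0 < A by rewrite /A; lra.
(* The product [t * (K1 + K2)] will bound [D^(w j) * ||D x_j||] in the other case; the factor 2
   makes it strictly less than [eps]. *)
pose t : R := Num.min 1 (eps / (2 * (K1%:R + K2%:R))).
have t0 : 0 < t by rewrite lt_min ltr01 divr_gt0 // mulr_gt0.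
have t01 : 0 < t <= 1 by rewrite t0 ge_min lexx.
have t_eps : t * (K1%:R + K2%:R) < eps.
  have : t * (2 * (K1%:R + K2%:R)) <= eps.
    by rewrite -ler_pdivlMr ?ge_min ?lexx ?orbT ?mulr_gt0.
  have : 0 < t * (K1%:R + K2%:R) by rewrite mulr_gt0.
  lra.
(* The exponent [W + 1] satisfies [w j * (W + 1) >= 1] for all [j]. *)
have [W Ww] := exists_scale w0 ler01.
have tW1 : 0 < t ^+ W.+1 <= 1.
  by rewrite exprn_gt0 //= exprn_ile1 ?(ltW t0) //; case/andP: t01.
(* As [a2 <= K2] and [a1 <= K1], this gives [a2 f1 + a1 f2 <= kappa A Q <= t^(W + 1) Q]. The summand
   1 of [A] ensures [kappa <= 1/10]. *)
pose kappa := t ^+ W.+1 / (10 * A).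
have kA : kappa * A = t ^+ W.+1 / 10 by rewrite /kappa; field; rewrite gt_eqF.
have k0 : 0 < kappa by rewrite divr_gt0 ?mulr_gt0 //; case/andP: tW1.
have [tW0 tW_le1] := andP tW1.
have kK2A1 : 0 <= kappa * (K2%:R * A1) by rewrite mulr_ge0 ?(ltW k0) ?mulr_ge0.
have kK1A2 : 0 <= kappa * (K1%:R * A2) by rewrite mulr_ge0 ?(ltW k0) ?mulr_ge0.
have kA1 : kappa * A1 <= kappa * (K2%:R * A1) by rewrite ler_wpM2l ?(ltW k0).
have kA2 : kappa * A2 <= kappa * (K1%:R * A2) by rewrite ler_wpM2l ?(ltW k0).
have kAE : kappa * A
  = kappa * (K2%:R * A1) + kappa * (K1%:R * A2) + kappa by rewrite /A; ring.
have k01 : 0 < kappa <= 10^-1 by rewrite k0 /=; lra.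
exists (1 - kappa); first by lra.
(* This makes [Q^(w j)] exceed [K1 + K2], so the combined errors are less than 1. *)
exists ((K1 + K2).+1 ^ W.+1)%N => Q QQ0.
have Q0 : (0 < Q)%N by apply: leq_trans QQ0; rewrite expn_gt0.
have Q0R : 0 < Q%:R :> R by rewrite ltr0n.
apply: contrapT => nosol.
have {}nosol q : (0 < q <= Q)%N ->
    ~ approximable (fun j => (1 - kappa) * Q%:R `^ (- w j)) x q.
  by move=> qQ qx; apply: nosol; exists q.
have [|a1 [f1 [a1K q1K f1A ux]]] :=
    near_multiple_dirichlet (leqnn 4) Q0 w_ge0 w1 k01 _ nosol.
  by rewrite -/K1 -/A1; lra.
have [|a2 [f2 [a2K _ f2A vx]]] :=
    near_multiple_dirichlet N4 Q0 w_ge0 w1 k01 _ nosol.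
  by rewrite -/K2 -/A2; lra.
pose l j := Q%:R `^ (- w j).
have l0 j : 0 < l j by rewrite powR_gt0.
have Ql j : Q%:R `^ w j * l j = 1 by rewrite /l powRN divff ?gt_eqF ?powR_gt0.
have leN4 : N%:R^-1 <= 4^-1 :> R by rewrite lef_pV2 ?posrE ?ler_nat.
have comb j : a2%:R * (l j / 4) + a1%:R * (l j / N%:R)
    <= (K1%:R + K2%:R) * l j.
  have a1R : a1%:R <= K1%:R :> R by rewrite ler_nat; case/andP: a1K.
  have a2R : a2%:R <= K2%:R :> R by rewrite ler_nat; case/andP: a2K.
  have : a1%:R * l j <= K1%:R * l j by rewrite ler_wpM2r ?(ltW (l0 j)).
  have : a2%:R * l j <= K2%:R * l j by rewrite ler_wpM2r ?(ltW (l0 j)).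
  have : a1%:R * (l j / N%:R) <= a1%:R * (l j / 4).
    by rewrite !ler_wpM2l ?(ltW (l0 j)).
  have : 0 <= a1%:R * l j by rewrite mulr_ge0 ?(ltW (l0 j)).
  have : 0 <= a2%:R * l j by rewrite mulr_ge0 ?(ltW (l0 j)).
  by lra.
pose q1 := (a1 * Q.+1 + f1)%N; pose q2 := (a2 * Q.+1 + f2)%N.
have q1_gt0 : (0 < q1)%N.
  by case/andP: a1K => a1_gt0 _; rewrite addn_gt0 muln_gt0 a1_gt0.
have q1E : a2%:R * q1%:R - a1%:R * q2%:R = a2%:R * f1%:R - a1%:R * f2%:R :> R.
  by rewrite !natrD !natrM; ring.
(* Equality means that [a2 q1 = a1 q2]. Then [q1 <= K1 Q] has errors at most [K1 * l j / N], against
   badness. *)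
have [e|ne] := eqVneq (a2 * f1)%N (a1 * f2)%N.
  have [j badj] := bad q1 q1_gt0.
  have [p1 /ltW p1x] := ux j; have [p2 /ltW p2x] := vx j.
  have small : (K1%:R + K2%:R) * l j < 1.
    rewrite -[ltRHS](Ql j) ltr_pM2r //.
    apply: (@lt_le_trans _ _ (K1 + K2).+1%:R); first by rewrite -natrD ltr_nat.
    by apply: (@powR_scale_ge _ _ _ _ W.+1); rewrite ?ler1n // -natrX ler_nat.
  have := badj p1; apply/negP; rewrite -ltNge.
  have := @approx_of_proportional R _ _ _ _ p1 p2 a1 a2 _ _ p1x p2x
    (le_lt_trans (comb j) small).
  case/andP: a2K => -> _ /(_ isT) approx.
  have {approx} : `|q1%:R * x j - p1%:~R| <= a1%:R * (l j / N%:R).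
    apply: approx; apply/eqP; rewrite -subr_eq0 !mulrA -mulrBl q1E.
    by rewrite -!natrM e subrr mul0r.
  move=> approx; apply: le_lt_trans NK.
  have -> : K1%:R ^+ 2 / N%:R
      = (K1%:R * Q%:R `^ w j) * (K1%:R * (l j / N%:R)) :> R.
    by rewrite -[LHS]mulr1 -[X in _ * X = _](Ql j); ring.
  apply: ler_pM; rewrite ?powR_ge0 //.
    apply: (@le_trans _ _ ((K1%:R * Q%:R) `^ w j)).
      rewrite ge0_ler_powR ?nnegrE // -natrM ler_nat.
      exact: q1K.
    by rewrite powRM // ler_wpM2r ?powR_ge0 // ler1_powR.
  apply: le_trans approx _; rewrite ler_wpM2r ?divr_ge0 ?(ltW (l0 j)) //.
  by rewrite ler_nat; case/andP: a1K.
(* [D] is the absolute value of [a2 f1 - a1 f2], which equals [a2 q1 - a1 q2]. *)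
have [D D0 [D_le Dx]] : exists2 D : nat, (0 < D)%N &
    D%:R <= t ^+ W.+1 * Q%:R /\ forall j, exists p : int,
      `|D%:R * x j - p%:~R| <= (K1%:R + K2%:R) * l j.
  have f_le : a2%:R * f1%:R + a1%:R * f2%:R <= t ^+ W.+1 * Q%:R.
    have : a2%:R * f1%:R <= K2%:R * (kappa * A1 * Q%:R).
      by rewrite ler_pM // ler_nat; case/andP: a2K.
    have : a1%:R * f2%:R <= K1%:R * (kappa * A2 * Q%:R).
      by rewrite ler_pM // ler_nat; case/andP: a1K.
    have : kappa * A * Q%:R <= t ^+ W.+1 * Q%:R.
      by rewrite ler_wpM2r // kA; lra.
    have : 0 < kappa * Q%:R by rewrite mulr_gt0.
    by rewrite /A; lra.
  have comb_approx j : exists p : int,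
      `|(a2%:R * f1%:R - a1%:R * f2%:R) * x j - p%:~R| <= (K1%:R + K2%:R) * l j.
    have [p1 /ltW p1x] := ux j; have [p2 /ltW p2x] := vx j.
    exists (a2%:Z * p1 - a1%:Z * p2); apply: le_trans (comb j).
    by rewrite -q1E mulrBl -!mulrA; apply: combination_approx.
  have [lt|le] := ltnP (a1 * f2) (a2 * f1).
    exists (a2 * f1 - a1 * f2)%N; first by rewrite subn_gt0.
    rewrite natrB ?(ltnW lt) // !natrM; split=> //.
    have : 0 <= a1%:R * f2%:R :> R by rewrite mulr_ge0.
    lra.
  exists (a1 * f2 - a2 * f1)%N; first by rewrite subn_gt0 ltn_neqAle ne.
  rewrite natrB // !natrM; split.
    have : 0 <= a2%:R * f1%:R :> R by rewrite mulr_ge0.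
    lra.
  move=> j; have [p px] := comb_approx j; exists (- p).
  rewrite -normrN (_ : - _ = (a2%:R * f1%:R - a1%:R * f2%:R) * x j - p%:~R) //.
  by rewrite rmorphN /=; ring.
have [j badj] := bad D D0; have [p px] := Dx j.
have := badj p; apply/negP; rewrite -ltNge; apply: le_lt_trans t_eps.
have -> : t * (K1%:R + K2%:R) = (t * Q%:R `^ w j) * ((K1%:R + K2%:R) * l j).
  by rewrite -[LHS]mulr1 -[X in _ * X = _](Ql j); ring.
apply: ler_pM; rewrite ?powR_ge0 //.
apply: le_trans (powR_scale_le t01 (ltW Q0R) (Ww j)).
by rewrite ge0_ler_powR ?nnegrE // mulr_ge0 // ltW.
Qed.

(** * Distance to the nearest integer, lower limits and zero weights *)

Local Open Scope classical_set_scope.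

Lemma dist_int_le (R : realType) (x : R) (p : int) :
  dist_int x <= `|x - p%:~R|.
Proof.
by apply: ge_inf; [exists 0 => _ [m _ <-] | exists p].
Qed.

Lemma dist_int_le_half (R : realType) (x : R) : dist_int x <= 2^-1.
Proof.
have /andP[fl fr] := floor_itv x; rewrite intrD in fr.
have h1 := dist_int_le x (Num.floor x).
have h2 := dist_int_le x (Num.floor x + 1).
rewrite intrD in h2; rewrite ger0_norm in h1; last by lra.
by rewrite ler0_norm in h2; lra.
Qed.

Lemma limn_einf_gt0 (R : realType) (u : nat -> R) :
  (0 < limn_einf (fun q => (u q)%:E))%E ->
  exists2 eps : R, 0 < eps & exists q0, forall q, (q0 <= q)%N -> eps <= u q.
Proof.
rewrite limn_einf_lim (cvg_lim _ (@cvg_einfs_sup _ _)) //.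
move=> /ereal_sup_gt[_ [q0 _ <-]] inf_gt0.
have inf_le q : (q0 <= q)%N -> (einfs (fun q => (u q)%:E) q0 <= (u q)%:E)%E.
  by move=> q0q; apply: ereal_inf_lbound; exists q.
(* The real number [u q0] lies above the tail infimum, which is therefore not infinite. *)
have := inf_le q0 (leqnn _); move: inf_gt0 inf_le.
case: (einfs _ q0) => [e| |] //; rewrite lte_fin => e0 le_u _.
by exists e => //; exists q0 => q /le_u; rewrite lee_fin.
Qed.

(** By Dirichlet's theorem some bounded multiple [s * q] with [s * q >= q0] has all its errors below
    [1 / N < eps], so a coordinate of weight 0 cannot witness badness at [s * q]. Going back from
    [s * q] to [q] costs a factor at most [s^(w j) * s <= P^2]. *)
Lemma bad_drop_zero_weights (R : realType) (I : finType) (w x : I -> R)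
    (eps : R) (q0 : nat) :
  (forall j, 0 <= w j <= 1) -> 0 < eps ->
  (forall q, (q0 <= q)%N ->
    exists j, forall p : int, eps <= q%:R `^ w j * `|q%:R * x j - p%:~R|) ->
  exists2 eps' : R, 0 < eps' & forall q, (0 < q)%N ->
    exists2 j, 0 < w j &
      forall p : int, eps' <= q%:R `^ w j * `|q%:R * x j - p%:~R|.
Proof.
move=> w01 eps0 bad.
pose N := (Num.truncn eps^-1).+1.
have Neps : N%:R^-1 < eps.
  by rewrite -[ltRHS]invrK ltf_pV2 ?posrE ?invr_gt0 ?ltr0n // truncnS_gt.
pose P := (N ^ #|I| * q0.+1)%N.
have P0 : 0 < P%:R :> R by rewrite ltr0n muln_gt0 expn_gt0.
exists (eps / P%:R ^+ 2); first by rewrite divr_gt0 // exprn_gt0.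
move=> q q_gt0; apply: contrapT => /forall2NP none.
have [//|m /andP[m0 mN] mx] :=
  simultaneous_dirichlet (fun j => (q0.+1 * q)%:R * x j) (N := fun=> N).
have [|j badj] := bad (m * (q0.+1 * q))%N.
  by apply: leq_trans (leq_pmull _ m0); apply: leq_trans (leq_pmulr _ q_gt0).
have /andP[w_ge0 w_le1] := w01 j.
have [wj0|wj0] := eqVneq (w j) 0.
  have [p px] := mx j.
  have := badj p; rewrite wj0 powRr0 mul1r natrM -mulrA.
  by move=> /(lt_le_trans Neps)/(lt_trans px); rewrite ltxx.
have [|] := none j; first by rewrite lt_neqAle eq_sym wj0 w_ge0.
move=> /existsNP[p /negP]; rewrite -ltNge => px.
pose s := (m * q0.+1)%N.
have s0 : (0 < s)%N by rewrite muln_gt0 m0.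
have sP : s%:R <= P%:R :> R.
  rewrite ler_nat leq_mul2r; apply/orP; right; apply: leq_trans mN _.
  by rewrite prod_nat_const.
have := badj (s%:Z * p); apply/negP; rewrite -ltNge mulnA -/s natrM.
rewrite intrM -pmulrn -mulrA -mulrBr normrM normr_nat powRM // mulrACA.
apply: (@le_lt_trans _ _ (P%:R ^+ 2 * (q%:R `^ w j * `|q%:R * x j - p%:~R|))).
  rewrite ler_wpM2r ?mulr_ge0 ?powR_ge0 // expr2 ler_pM ?powR_ge0 //.
  by apply: le_trans (ler1_powR _ w_le1) sP; rewrite ler1n.
by rewrite mulrC -ltr_pdivlMr // exprn_gt0.
Qed.

Theorem theorem4p6 (R : realType) (n : nat) (i : 'rV[R]_n)
  (hi : weight_vector i) : Bad i `<=` Dirichlet_improvable i.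
Proof.
case: hi => i01 i1 a /limn_einf_gt0[eps eps0 [q0 bad_a]].
have {}bad_a q : (q0 <= q)%N -> exists j : 'I_n, forall p : int,
    eps <= q%:R `^ i 0 j * `|q%:R * a 0 j - p%:~R|.
  move=> /bad_a; apply: contraPP => /forallNP none; apply/negP.
  rewrite -ltNge; apply/bigmax_ltP; split=> // j _.
  have /existsNP[p /negP] := none j; rewrite -ltNge; apply: le_lt_trans.
  by rewrite ler_wpM2l ?powR_ge0 // dist_int_le.
have [e e0 bad_pos] := bad_drop_zero_weights i01 eps0 bad_a.
pose J : {pred 'I_n} := [pred j | 0 < i 0 j].
pose I := {j : 'I_n | j \in J}.
have [|||c /andP[c0 c1] [Q0 DI]] := @bad_positive_weights_improvable R I
  (fun j => i 0 (val j)) (fun j => a 0 (val j)) e _ _ e0.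
- by case=> j.
- rewrite -(big_sub J (fun j => i 0 j)) -[RHS]i1.
  rewrite [RHS](bigID J) /= [X in _ + X]big1 ?addr0 // => j.
  rewrite -leNgt => ij; apply/le_anti; rewrite ij.
  by case/andP: (i01 j).
- move=> q /bad_pos[j ij jp].
  by exists (exist _ j ij).
(* Any constant in [(1/2, 1)] handles the coordinates of weight 0, since [dist_int] is at most
   [1/2]. *)
exists (Num.max c (2 / 3)).
  by rewrite lt_max c0 gt_max c1; lra.
exists (maxn Q0 1) => // Q /=; rewrite geq_max => /andP[Q0Q Q_gt0].
have [q qQ qx] := DI Q Q0Q; exists q => // j.
have [ij|] := boolP (0 < i 0 j).
  have [p px] := qx (exist _ j ij); apply: le_lt_trans (dist_int_le _ p) _.
  apply: lt_le_trans px _.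
  by rewrite ler_wpM2r ?powR_ge0 // le_max lexx.
rewrite -leNgt => ij.
have -> : i 0 j = 0 by apply/le_anti; rewrite ij; case/andP: (i01 j).
rewrite oppr0 powRr0 mulr1; apply: le_lt_trans (dist_int_le_half _) _.
by rewrite lt_max; apply/orP; right; lra.
Qed.
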